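(* For every positive equivalence relation $\eta$ such that $[x]$ is infinite for every $x\in\mathbb N$, the ascending family $\{A_n:n\in\mathbb N\}$ is conservatively explanatorily learnable.
   Context: A positive equivalence relation is an equivalence relation $\eta$ on $\mathbb{N}$ that is recursively enumerable (as a set of pairs) and has infinitely many equivalence classes. For $x\in\mathbb N$ let $[x]=\{y:y\,\eta\,x\}$. Let $a_0<a_1<\cdots$ be the least elements of the $\eta$-equivalence classes in increasing order and $A_n=\bigcup_{m<n}[a_m]$. $W_0,W_1,\dots$ is a fixed acceptable numbering of the r.e. sets. A text for $L$ is a total $T:\mathbb N\to\mathbb N\cup\{\#\}$ whose range minus $\{\#\}$ is $L$; $T[n]$ is its initial segment of length $n$ and $\mathrm{cnt}(\sigma)$ the set of numbers occurring in $\sigma$. A learner is a recursive function $M$ from finite sequences over $\mathbb N\cup\{\#\}$ to $\mathbb N\cup\{?\}$; an output $e$ is interpreted as the hypothesis $W_e$ (the $\eta$-closure of $W_e$). $M$ conservatively explanatorily learns $\mathcal C$ if on every text $T$ for every $L\in\mathcal C$ it outputs from some point on a single index whose hypothesis equals $L$, and for all $n$ and $k\ge1$, $M(T[n])\ne M(T[n+k])$ only if $\mathrm{cnt}(T[n+k])\not\subseteq W_{M(T[n])}$. *)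

(* Defs.v *)
From Stdlib Require Import List Cantor RelationClasses.
From Stdlib Require Fin Vector.
Import ListNotations.

(** Kleene's total recursive functions of [n] arguments: the least class that
    contains the initial functions and is closed under composition, primitive
    recursion (on the first argument) and minimization of regular functions. *)
Inductive recursive : forall n : nat, (Vector.t nat n -> nat) -> Prop :=
| rec_zero : recursive 0 (fun _ => 0)
| rec_succ : recursive 1 (fun v => S (Vector.hd v))
| rec_proj (n : nat) (i : Fin.t n) : recursive n (fun v => Vector.nth v i)
| rec_comp (m n : nat) (f : Vector.t nat m -> nat)
    (g : Vector.t (Vector.t nat n -> nat) m) :
    recursive m f ->
    (forall i : Fin.t m, recursive n (Vector.nth g i)) ->
    recursive n (fun v => f (Vector.map (fun gi => gi v) g))
| rec_prec (n : nat) (f : Vector.t nat n -> nat)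
    (g : Vector.t nat (S (S n)) -> nat) :
    recursive n f ->
    recursive (S (S n)) g ->
    recursive (S n) (fun v =>
      nat_rect (fun _ => nat)
        (f (Vector.tl v))
        (fun y r => g (Vector.cons nat y _ (Vector.cons nat r _ (Vector.tl v))))
        (Vector.hd v))
(* The premise on [h] says that [h v] is the least zero of [f (_, v)]; in
   particular a zero exists for every [v], so [h] is total. *)
| rec_mu (n : nat) (f : Vector.t nat (S n) -> nat) (h : Vector.t nat n -> nat) :
    recursive (S n) f ->
    (forall v, f (Vector.cons nat (h v) _ v) = 0 /\
               forall y, y < h v -> f (Vector.cons nat y _ v) <> 0) ->
    recursive n h.

Definition recursive1 (f : nat -> nat) : Prop :=
  recursive 1 (fun v => f (Vector.hd v)).

(** A set of pairs is r.e. if it is empty or the range of a recursive function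
    into pairs, given here by its two coordinates. *)
Definition re_pairs (P : nat -> nat -> Prop) : Prop :=
  (forall x y, ~ P x y) \/
  exists f g : nat -> nat, recursive1 f /\ recursive1 g /\
    forall x y, P x y <-> exists s, f s = x /\ g s = y.

(** [W e x] stands for "x belongs to W_e".  The numbering is uniformly r.e., and
    every uniformly r.e. sequence of sets is effectively translatable into it;
    on constant sequences the latter says that every r.e. set is some W_e. *)
Definition acceptable (W : nat -> nat -> Prop) : Prop :=
  re_pairs W /\
  forall V : nat -> nat -> Prop, re_pairs V ->
    exists f : nat -> nat, recursive1 f /\
      forall i x, W (f i) x <-> V i x.

Definition infinite (P : nat -> Prop) : Prop :=
  forall l : list nat, exists y, P y /\ ~ In y l.

Definition eq_class (eta : nat -> nat -> Prop) (x : nat) : nat -> Prop :=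
  fun y => eta y x.

(** The last conjunct says that no finite list of classes covers the natural
    numbers, i.e. that there are infinitely many classes. *)
Definition positive_equivalence (eta : nat -> nat -> Prop) : Prop :=
  Equivalence eta /\
  re_pairs eta /\
  forall l : list nat, exists x, forall y, In y l -> ~ eq_class eta y x.

Definition least_in_class (eta : nat -> nat -> Prop) (x : nat) : Prop :=
  forall y, eq_class eta x y -> x <= y.

(** [a] is the (unique, in general non-recursive) increasing enumeration of the
    least elements of the classes. *)
Definition enumerates_least (eta : nat -> nat -> Prop) (a : nat -> nat) : Prop :=
  (forall n, a n < a (S n)) /\
  forall x, least_in_class eta x <-> exists n, a n = x.

(** The set A_n; in particular A_0 is empty. *)
Definition ascending_set (eta : nat -> nat -> Prop) (a : nat -> nat) (n : nat)
  : nat -> Prop :=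
  fun x => exists m, m < n /\ eq_class eta (a m) x.

Definition ascending_family (eta : nat -> nat -> Prop) (a : nat -> nat)
  : (nat -> Prop) -> Prop :=
  fun L => exists n, forall x, L x <-> ascending_set eta a n x.

(** [None] is the pause symbol # in texts and the symbol ? in learner outputs. *)
Definition is_text (T : nat -> option nat) (L : nat -> Prop) : Prop :=
  forall x, L x <-> exists n, T n = Some x.

Definition initial_segment (T : nat -> option nat) (n : nat) : list (option nat) :=
  map T (seq 0 n).

Definition cnt (sigma : list (option nat)) : nat -> Prop :=
  fun x => In (Some x) sigma.

Definition encode_option (o : option nat) : nat :=
  match o with
  | None => 0
  | Some x => S x
  end.

Fixpoint encode_list (sigma : list (option nat)) : nat :=
  match sigma with
  | [] => 0
  | o :: tau => S (Cantor.to_nat (encode_option o, encode_list tau))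
  end.

Definition recursive_learner (M : list (option nat) -> option nat) : Prop :=
  exists f : nat -> nat, recursive1 f /\
    forall sigma, encode_option (M sigma) = f (encode_list sigma).

(** The hypothesis given by the index [e]: the eta-closure of W_e. *)
Definition hypothesis (W eta : nat -> nat -> Prop) (e : nat) : nat -> Prop :=
  fun x => exists y, W e y /\ eta x y.

Definition converges_to (W eta : nat -> nat -> Prop)
  (M : list (option nat) -> option nat) (T : nat -> option nat)
  (L : nat -> Prop) : Prop :=
  exists e N, (forall n, N <= n -> M (initial_segment T n) = Some e) /\
    forall x, hypothesis W eta e x <-> L x.

(** Inclusion is tested against the r.e. set W_e itself, not against its
    eta-closure; the output ? names no set and may be abandoned freely. *)
Definition conservative_on (W : nat -> nat -> Prop)
  (M : list (option nat) -> option nat) (T : nat -> option nat) : Prop :=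
  forall n k e, 1 <= k ->
    M (initial_segment T n) = Some e ->
    M (initial_segment T n) <> M (initial_segment T (n + k)) ->
    ~ (forall x, cnt (initial_segment T (n + k)) x -> W e x).

Definition conservatively_explanatorily_learnable (W eta : nat -> nat -> Prop)
  (C : (nat -> Prop) -> Prop) : Prop :=
  exists M : list (option nat) -> option nat,
    recursive_learner M /\
    forall L, C L -> forall T, is_text T L ->
      converges_to W eta M T L /\ conservative_on W M T.

(* Main.v *)
(** The learner conjectures the initial segment [{0, ..., m - 1}], where [m] is
    the least number that does not occur in the data.  Every number below [a_n]
    lies in [A_n] while [a_n] does not, so on a text for [A_n] the number [m]
    increases to [a_n], and the [eta]-closure of [{0, ..., a_n - 1}] is [A_n].
    If [m] increases, then its old value has occurred, and this value is
    not in the old conjecture. *)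
Require Import Defs.
From Stdlib Require Import List Cantor RelationClasses PeanoNat Lia Classical
  FunctionalExtensionality ConstructiveEpsilon.
From Stdlib Require Fin Vector.

(** * Closure properties of the recursive functions *)

Definition recursive2 (f : nat -> nat -> nat) : Prop :=
  recursive 2 (fun v => f (Vector.hd v) (Vector.hd (Vector.tl v))).

(** The constructors of [recursive] yield functions of fixed shapes; functional extensionality lets
    a pointwise equal, more convenient expression replace them. *)
Lemma recursive_ext (n : nat) (f g : Vector.t nat n -> nat) :
  recursive n f -> (forall v, f v = g v) -> recursive n g.
Proof.
  intros Hf E. rewrite <- (functional_extensionality _ _ E). exact Hf.
Qed.

Lemma recursive_hd (n : nat) : recursive (S n) (fun v => Vector.hd v).
Proof.
  apply recursive_ext with (1 := rec_proj (S n) Fin.F1).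
  intros v. now rewrite (Vector.eta v).
Qed.

Fixpoint tabulate {A : Type} (n : nat) : (Fin.t n -> A) -> Vector.t A n :=
  match n with
  | 0 => fun _ => Vector.nil A
  | S n => fun f => Vector.cons A (f Fin.F1) n (tabulate n (fun i => f (Fin.FS i)))
  end.

Lemma nth_tabulate {A : Type} (n : nat) (f : Fin.t n -> A) (i : Fin.t n) :
  Vector.nth (tabulate n f) i = f i.
Proof.
  induction i as [n | n i IH]; simpl; [reflexivity | apply (IH (fun i => f (Fin.FS i)))].
Qed.

(** [rec_comp] takes a vector of functions; a single vector-valued [g] is brought into that form by
    tabulating its coordinates. *)
Lemma recursive_comp_vector (m n : nat) (f : Vector.t nat m -> nat)
  (g : Vector.t nat n -> Vector.t nat m) :
  recursive m f ->
  (forall i, recursive n (fun v => Vector.nth (g v) i)) ->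
  recursive n (fun v => f (g v)).
Proof.
  intros Hf Hg.
  apply recursive_ext with (f := fun v => f (Vector.map (fun gi => gi v)
    (tabulate m (fun i v => Vector.nth (g v) i)))).
  - apply rec_comp; [exact Hf|]. intros i. rewrite nth_tabulate. apply Hg.
  - intros v. f_equal. apply Vector.eq_nth_iff. intros i j <-.
    rewrite (Vector.nth_map _ _ i i eq_refl), nth_tabulate. reflexivity.
Qed.

Lemma recursive_tl (n : nat) (f : Vector.t nat n -> nat) :
  recursive n f -> recursive (S n) (fun v => f (Vector.tl v)).
Proof.
  intros Hf. apply (recursive_comp_vector n (S n) f); [exact Hf|]. intros i.
  apply recursive_ext with (1 := rec_proj (S n) (Fin.FS i)).
  intros v. now rewrite (Vector.eta v).
Qed.

Lemma recursive_comp1 (n : nat) (f : nat -> nat) (g : Vector.t nat n -> nat) :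
  recursive1 f -> recursive n g -> recursive n (fun v => f (g v)).
Proof.
  intros Hf Hg.
  apply (recursive_comp_vector 1 n _ (fun v => Vector.cons nat (g v) _ (Vector.nil nat)) Hf).
  intros i. apply (Fin.caseS' i); [exact Hg | apply Fin.case0].
Qed.

Lemma recursive_comp2 (n : nat) (f : nat -> nat -> nat) (g h : Vector.t nat n -> nat) :
  recursive2 f -> recursive n g -> recursive n h ->
  recursive n (fun v => f (g v) (h v)).
Proof.
  intros Hf Hg Hh.
  apply (recursive_comp_vector 2 n _ (fun v =>
    Vector.cons nat (g v) _ (Vector.cons nat (h v) _ (Vector.nil nat))) Hf).
  intros i. apply (Fin.caseS' i); [exact Hg|]. clear i. intros i.
  apply (Fin.caseS' i); [exact Hh | apply Fin.case0].
Qed.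

Lemma recursive_S (n : nat) (f : Vector.t nat n -> nat) :
  recursive n f -> recursive n (fun v => S (f v)).
Proof. apply recursive_comp1, rec_succ. Qed.

Lemma recursive_0 (n : nat) : recursive n (fun _ => 0).
Proof.
  apply (recursive_comp_vector 0 n _ (fun _ => Vector.nil nat) rec_zero).
  apply Fin.case0.
Qed.

(** Applies [rec_prec] with [k v] put in front of [v], so that the number of iterations may itself
    be computed from the parameters. *)
Lemma recursive_nat_rect (n : nat) (k f : Vector.t nat n -> nat)
  (g : nat -> nat -> Vector.t nat n -> nat) :
  recursive n k -> recursive n f ->
  recursive (S (S n)) (fun v =>
    g (Vector.hd v) (Vector.hd (Vector.tl v)) (Vector.tl (Vector.tl v))) ->
  recursive n (fun v => nat_rect (fun _ => nat) (f v) (fun y r => g y r v) (k v)).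
Proof.
  intros Hk Hf Hg.
  apply (recursive_comp_vector (S n) n _ (fun v => Vector.cons nat (k v) n v)
    (rec_prec n f _ Hf Hg)).
  intros i. apply (Fin.caseS' i); [exact Hk | apply rec_proj].
Qed.

(** [rec_mu] needs the minimizing function in advance. Being a zero is decidable, so constructive
    epsilon extracts the least zero from mere existence. *)
Lemma recursive_minimization (n : nat) (f : Vector.t nat (S n) -> nat) :
  recursive (S n) f ->
  (forall v, exists y, f (Vector.cons nat y n v) = 0) ->
  exists h, recursive n h /\
    forall v, f (Vector.cons nat (h v) n v) = 0 /\
      forall y, y < h v -> f (Vector.cons nat y n v) <> 0.
Proof.
  intros Hf Hex.
  pose (least v := epsilon_smallest _
    (fun y => Nat.eq_dec (f (Vector.cons nat y n v)) 0) (Hex v)).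
  assert (spec : forall v, f (Vector.cons nat (proj1_sig (least v)) n v) = 0 /\
    forall y, y < proj1_sig (least v) -> f (Vector.cons nat y n v) <> 0).
  { intros v. destruct (least v) as [y [Hy Hmin]]. simpl. split; [exact Hy|].
    intros z Hz E. specialize (Hmin z E). lia. }
  exists (fun v => proj1_sig (least v)). split; [|exact spec].
  exact (rec_mu n f _ Hf spec).
Qed.

Lemma recursive_add : recursive2 Nat.add.
Proof.
  apply recursive_ext with (f := fun v : Vector.t nat 2 => nat_rect (fun _ => nat)
    (Vector.hd (Vector.tl v)) (fun _ r => S r) (Vector.hd v)).
  - apply (recursive_nat_rect 2 _ _ (fun _ r _ => S r));
      auto using recursive_hd, recursive_tl, recursive_S.
  - intros v. induction (Vector.hd v); simpl; congruence.
Qed.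

Lemma recursive_pred : recursive1 Nat.pred.
Proof.
  apply recursive_ext with (f := fun v : Vector.t nat 1 => nat_rect (fun _ => nat)
    0 (fun y _ => y) (Vector.hd v)).
  - apply (recursive_nat_rect 1 _ _ (fun y _ _ => y)); auto using recursive_hd, recursive_0.
  - intros v. now destruct (Vector.hd v).
Qed.

Lemma recursive_sub : recursive2 Nat.sub.
Proof.
  apply recursive_ext with (f := fun v : Vector.t nat 2 => nat_rect (fun _ => nat)
    (Vector.hd v) (fun _ r => Nat.pred r) (Vector.hd (Vector.tl v))).
  - apply (recursive_nat_rect 2 _ _ (fun _ r _ => Nat.pred r));
      auto using recursive_hd, recursive_tl, recursive_comp1, recursive_pred.
  - intros v. induction (Vector.hd (Vector.tl v)); simpl; lia.
Qed.

(** With truncated subtraction, the inner sum is the distance of [x] and [y]. *)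
Definition eq_indicator (x y : nat) : nat := 1 - ((x - y) + (y - x)).

Lemma eq_indicator_0 (x y : nat) : eq_indicator x y = 0 <-> x <> y.
Proof. unfold eq_indicator. lia. Qed.

Lemma recursive_eq_indicator : recursive2 eq_indicator.
Proof.
  apply (recursive_comp2 2 Nat.sub); auto using recursive_sub, recursive_S, recursive_0.
  apply (recursive_comp2 2 Nat.add); [apply recursive_add| |];
    apply (recursive_comp2 2 Nat.sub); auto using recursive_sub, recursive_hd, recursive_tl.
Qed.

(** * Decoding *)

(** The triangular number w(w+1)/2, written with the recursor used inside [Cantor.to_nat], so that
    [to_nat_triangle] holds by computation. *)
Definition triangle (w : nat) : nat := nat_rect (fun _ => nat) 0 (fun i m => S i + m) w.

Lemma recursive_triangle : recursive1 triangle.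
Proof.
  apply (recursive_nat_rect 1 _ _ (fun i m _ => S i + m));
    auto using recursive_hd, recursive_0.
  apply (recursive_comp2 3 Nat.add); auto using recursive_add, recursive_hd, recursive_tl, recursive_S.
Qed.

Lemma triangle_S (w : nat) : triangle (S w) = S w + triangle w.
Proof. reflexivity. Qed.

Lemma triangle_mono (v w : nat) : v <= w -> triangle v <= triangle w.
Proof. induction 1; rewrite ?triangle_S; lia. Qed.

Lemma to_nat_triangle (x y : nat) : to_nat (x, y) = y + triangle (y + x).
Proof. reflexivity. Qed.

(* [w] is the least number with [n < triangle (S w)], that is, the sum of the
   coordinates of the pair coded by [n]. *)
Lemma recursive_unpair :
  exists p q, recursive1 p /\ recursive1 q /\
    forall x y, p (to_nat (x, y)) = x /\ q (to_nat (x, y)) = y.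
Proof.
  destruct (recursive_minimization 1
    (fun v => S (Vector.hd (Vector.tl v)) - triangle (S (Vector.hd v))))
    as (w & Hw & Hspec).
  - apply (recursive_comp2 2 Nat.sub); auto using recursive_sub, recursive_S, recursive_hd, recursive_tl.
    apply (recursive_comp1 2 triangle); auto using recursive_triangle, recursive_S, recursive_hd.
  (* The search ends by [n] itself, since [triangle (S n)] is at least [S n]. *)
  - intros v. exists (Vector.hd v). cbn [Vector.hd Vector.tl Vector.caseS].
    rewrite triangle_S. lia.
  - pose (w1 n := w (Vector.cons nat n _ (Vector.nil nat))).
    assert (Hw1 : recursive1 w1).
    { apply recursive_ext with (1 := Hw). intros v. unfold w1. f_equal.
      rewrite (Vector.eta v). f_equal. apply (Vector.case0 (fun u => u = _)). reflexivity. }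
    assert (Hq : recursive1 (fun n => n - triangle (w1 n))).
    { apply (recursive_comp2 1 Nat.sub); auto using recursive_sub, recursive_hd.
      apply (recursive_comp1 1 triangle); auto using recursive_triangle. }
    exists (fun n => w1 n - (n - triangle (w1 n))), (fun n => n - triangle (w1 n)).
    split; [|split; [exact Hq|]].
    + apply (recursive_comp2 1 Nat.sub); auto using recursive_sub.
    + intros x y.
      assert (E : w1 (to_nat (x, y)) = y + x).
      { destruct (Hspec (Vector.cons nat (to_nat (x, y)) _ (Vector.nil nat))) as [H0 Hlt].
        fold (w1 (to_nat (x, y))) in H0, Hlt.
        cbn [Vector.hd Vector.tl Vector.caseS] in H0, Hlt.
        rewrite to_nat_triangle in *.
        (* A smaller value would give [triangle (S w1) <= triangle (y + x)], so it is no zero; a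
           larger one is not least, as [y + x] is already a zero. *)
        destruct (Nat.lt_trichotomy (w1 (y + triangle (y + x))) (y + x)) as [H | [H | H]].
        - pose proof (triangle_mono _ _ H). lia.
        - exact H.
        - destruct (Hlt _ H). rewrite triangle_S. lia. }
      rewrite E, to_nat_triangle. lia.
Qed.

Lemma finite_range_bounded (u : nat -> nat) (k : nat) :
  exists z, forall i, i < k -> u i <= z.
Proof.
  induction k as [|k [z Hz]]; [exists 0; lia|].
  exists (z + u k). intros i Hi. destruct (Nat.eq_dec i k) as [-> | Hne]; [lia|].
  specialize (Hz i). lia.
Qed.

(** Iterating [c => q (pred c)] drops entries from the front of the coded list, and [p (pred c)]
    reads the first remaining one. The code of a list exceeds each of its positions, so it can bound
    the search. *)
Lemma in_encode_list (p q : nat -> nat)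
  (Hpq : forall x y, p (to_nat (x, y)) = x /\ q (to_nat (x, y)) = y)
  (sigma : list (option nat)) (z : nat) :
  In (Some z) sigma <->
  exists i, i < encode_list sigma /\
    p (Nat.pred (Nat.iter i (fun c => q (Nat.pred c)) (encode_list sigma))) = S z.
Proof.
  destruct (Hpq 0 0) as [Hp0 Hq0]. change (to_nat (0, 0)) with 0 in Hp0, Hq0.
  split.
  - induction sigma as [|o tau IH]; intros Hin; [destruct Hin|].
    destruct (Hpq (encode_option o) (encode_list tau)) as [Ep Eq].
    cbn [encode_list]. destruct Hin as [-> | Hin].
    + exists 0. split; [lia | exact Ep].
    + destruct (IH Hin) as (i & Hi & E). exists (S i). split.
      * rewrite to_nat_triangle. lia.
      * rewrite Nat.iter_succ_r. cbn [Nat.pred]. rewrite Eq. exact E.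
  (* No bound on [i] is kept: past the end the iterates stay at 0, where [p] reads 0, which differs
     from [S z]. *)
  - intros (i & _ & E). revert i E.
    induction sigma as [|o tau IH]; intros i E.
    + assert (Z : Nat.iter i (fun c => q (Nat.pred c)) 0 = 0).
      { induction i as [|i IHi]; [reflexivity|].
        rewrite Nat.iter_succ_r. cbn [Nat.pred]. rewrite Hq0. apply IHi.
        cbn [encode_list] in *. rewrite Nat.iter_succ_r in E. cbn [Nat.pred] in E.
        rewrite Hq0 in E. exact E. }
      cbn [encode_list] in E. rewrite Z in E. cbn [Nat.pred] in E. congruence.
    + destruct (Hpq (encode_option o) (encode_list tau)) as [Ep Eq].
      cbn [encode_list] in E. destruct i as [|i].
      * left. change (p (to_nat (encode_option o, encode_list tau)) = S z) in E.
        rewrite Ep in E. destruct o; simpl in E; congruence.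
      * right. apply (IH i). rewrite Nat.iter_succ_r in E. cbn [Nat.pred] in E.
        rewrite Eq in E. exact E.
Qed.

(** * The least number missing from a finite sequence *)

Definition count_eq (u : nat -> nat) (k x : nat) : nat :=
  nat_rect (fun _ => nat) 0 (fun i r => r + eq_indicator (u i) x) k.

(** Turns a bounded universal statement into a zero test, as minimization requires. *)
Lemma count_eq_0 (u : nat -> nat) (k x : nat) :
  count_eq u k x = 0 <-> forall i, i < k -> u i <> x.
Proof.
  unfold count_eq. induction k as [|k IH]; cbn [nat_rect]; [split; [lia | reflexivity]|].
  rewrite Nat.eq_add_0, IH, eq_indicator_0. split.
  - intros [Hlt Hk] i Hi. destruct (Nat.eq_dec i k) as [-> | Hne]; [exact Hk|].
    apply Hlt. lia.
  - auto with arith.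
Qed.

Lemma recursive_mex :
  exists h, recursive1 h /\
    forall sigma, ~ cnt sigma (h (encode_list sigma)) /\
      forall y, y < h (encode_list sigma) -> cnt sigma y.
Proof.
  destruct recursive_unpair as (p & q & Hp & Hq & Hpq).
  pose (u c i := p (Nat.pred (Nat.iter i (fun c => q (Nat.pred c)) c))).
  assert (Hu : recursive2 u).
  { apply (recursive_comp1 2 p); [exact Hp|].
    apply (recursive_comp1 2 Nat.pred); [exact recursive_pred|].
    apply (recursive_nat_rect 2 _ _ (fun _ r _ => q (Nat.pred r)));
      auto using recursive_hd, recursive_tl.
    apply (recursive_comp1 4 q); [exact Hq|].
    apply (recursive_comp1 4 Nat.pred); auto using recursive_pred, recursive_hd, recursive_tl. }
  (* The search is for [S y] among the decoded entries, because [encode_option] shifts numbers by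
     one and keeps 0 for the pause symbol. *)
  destruct (recursive_minimization 1 (fun v =>
    count_eq (u (Vector.hd (Vector.tl v))) (Vector.hd (Vector.tl v)) (S (Vector.hd v))))
    as (h & Hh & Hspec).
  - apply (recursive_nat_rect 2 _ _ (fun i r v =>
      r + eq_indicator (u (Vector.hd (Vector.tl v)) i) (S (Vector.hd v))));
      auto using recursive_hd, recursive_tl, recursive_0.
    apply (recursive_comp2 4 Nat.add); auto using recursive_add, recursive_hd, recursive_tl.
    apply (recursive_comp2 4 eq_indicator);
      [apply recursive_eq_indicator | | apply recursive_S].
    (* The four arguments are the loop index, the partial count, the candidate and the code of the
       sequence. *)
    + apply (recursive_comp2 4 u); auto using recursive_hd.
      exact (recursive_tl 3 _ (recursive_tl 2 _ (recursive_tl 1 _ (recursive_hd 0)))).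
    + exact (recursive_tl 3 _ (recursive_tl 2 _ (recursive_hd 1))).

  - intros v. destruct (finite_range_bounded (u (Vector.hd v)) (Vector.hd v)) as [z Hz].
    exists z. apply count_eq_0. cbn [Vector.hd Vector.tl Vector.caseS].
    intros i Hi. specialize (Hz i Hi). lia.
  - exists (fun c => h (Vector.cons nat c _ (Vector.nil nat))). split.
    + apply recursive_ext with (1 := Hh). intros v. f_equal.
      rewrite (Vector.eta v). f_equal. apply (Vector.case0 (fun w => w = _)). reflexivity.
    + intros sigma.
      destruct (Hspec (Vector.cons nat (encode_list sigma) _ (Vector.nil nat))) as [H0 Hlt].
      cbn [Vector.hd Vector.tl Vector.caseS] in H0, Hlt.
      split.
      * intros Hin. apply (in_encode_list p q Hpq) in Hin. destruct Hin as (i & Hi & E).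
        exact (proj1 (count_eq_0 _ _ _) H0 i Hi E).
      * intros y Hy. apply NNPP. intros Hout. apply (Hlt y Hy), count_eq_0.
        intros i Hi E. apply Hout, (in_encode_list p q Hpq). exists i. auto.
Qed.

(** Acceptability translates any uniformly r.e. sequence. The pairs with [x < m] are enumerated by
    letting [s] code [x] together with the difference [m - S x]. *)
Lemma initial_segments_indexed (W : nat -> nat -> Prop) (HW : acceptable W) :
  exists f, recursive1 f /\ forall m x, W (f m) x <-> x < m.
Proof.
  destruct HW as [_ Htr]. apply (Htr (fun m x => x < m)). right.
  destruct recursive_unpair as (p & q & Hp & Hq & Hpq).
  exists (fun s => S (p s + q s)), p. split; [|split; [exact Hp|]].
  - apply recursive_S, (recursive_comp2 1 Nat.add); auto using recursive_add.
  - intros m x. split.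
    + intros Hlt. exists (to_nat (x, m - S x)).
      destruct (Hpq x (m - S x)) as [-> ->]. lia.
    + intros (s & <- & <-). lia.
Qed.

(** * The sets [A_n] *)

Section AscendingSets.

Context (eta : nat -> nat -> Prop) (Heta : Equivalence eta)
  (a : nat -> nat) (Ha : enumerates_least eta a).

Lemma enumerates_least_mono (m n : nat) : m < n -> a m < a n.
Proof.
  destruct Ha as [Hinc _]. induction 1 as [|n _ IH]; [apply Hinc|].
  specialize (Hinc n). lia.
Qed.

Lemma ascending_set_closed (n x y : nat) :
  eta x y -> ascending_set eta a n x -> ascending_set eta a n y.
Proof.
  intros Hxy (m & Hm & Hx). exists m. split; [exact Hm|].
  unfold eq_class in *. now transitivity x.
Qed.

(** Otherwise [a n] would be equivalent to some smaller [a m], although it is least in its class. *)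
Lemma not_ascending_set_least (n : nat) : ~ ascending_set eta a n (a n).
Proof.
  intros (m & Hm & Hmn). pose proof (enumerates_least_mono m n Hm).
  assert (Hleast : least_in_class eta (a n)) by (apply Ha; now exists n).
  assert (Hnm : eq_class eta (a n) (a m)) by (apply (Equivalence_Symmetric (R := eta)), Hmn).
  specialize (Hleast _ Hnm). lia.
Qed.

(** Strong induction: a number that is not least in its class is equivalent to a smaller one, and a
    least one is some [a m], where monotonicity of [a] forces [m < n]. *)
Lemma ascending_set_below (n x : nat) : x < a n -> ascending_set eta a n x.
Proof.
  induction x as [x IH] using (well_founded_induction Wf_nat.lt_wf). intros Hx.
  destruct (classic (least_in_class eta x)) as [Hleast | Hnot].
  - apply Ha in Hleast. destruct Hleast as [m <-]. exists m. split; [|apply (Equivalence_Reflexive (R := eta))].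
    destruct (Nat.lt_trichotomy m n) as [H | [-> | H]]; [exact H | lia |].
    apply enumerates_least_mono in H. lia.
  - apply not_all_ex_not in Hnot. destruct Hnot as [y Hy].
    apply imply_to_and in Hy. destruct Hy as [Hxy Hlt].
    apply ascending_set_closed with y; [exact Hxy|]. apply IH; lia.
Qed.

Lemma closure_below_least (n x : nat) :
  (exists y, y < a n /\ eta x y) <-> ascending_set eta a n x.
Proof.
  split.
  - intros (y & Hy & Hxy). apply ascending_set_closed with y; [now symmetry|].
    now apply ascending_set_below.
  - intros (m & Hm & Hx). exists (a m). split; [now apply enumerates_least_mono|].
    exact Hx.
Qed.

End AscendingSets.

(** * Texts and the correctness of the learner *)

Lemma cnt_initial_segment (T : nat -> option nat) (n x : nat) :
  cnt (initial_segment T n) x <-> exists i, i < n /\ T i = Some x.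
Proof.
  unfold cnt, initial_segment. rewrite in_map_iff. split.
  - intros (i & E & Hi). apply in_seq in Hi. exists i. split; [lia | exact E].
  - intros (i & Hi & E). exists i. split; [exact E|]. apply in_seq. lia.
Qed.

Lemma text_exhausts_below (T : nat -> option nat) (L : nat -> Prop) (k : nat) :
  is_text T L -> (forall x, x < k -> L x) ->
  exists N, forall n x, N <= n -> x < k -> cnt (initial_segment T n) x.
Proof.
  intros HT. induction k as [|k IH]; intros Hk; [exists 0; lia|].
  destruct IH as [N HN]; [auto with arith|].
  destruct (proj1 (HT k) (Hk k (Nat.lt_succ_diag_r k))) as [i Hi].
  (* Late enough both for the numbers below [k] and for the position [i] at which [k] occurs. *)
  exists (N + S i). intros n x Hn Hx.
  destruct (Nat.eq_dec x k) as [-> | Hne]; [|apply HN; lia].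
  apply cnt_initial_segment. exists i. split; [lia | exact Hi].
Qed.

Theorem theorem16 (W : nat -> nat -> Prop) (HW : acceptable W)
  (eta : nat -> nat -> Prop) (Heta : positive_equivalence eta)
  (Hinf : forall x, infinite (eq_class eta x))
  (a : nat -> nat) (Ha : enumerates_least eta a) :
  conservatively_explanatorily_learnable W eta (ascending_family eta a).
Proof.
  destruct Heta as [Heq _].
  destruct recursive_mex as (h & Hh & Hmex).
  destruct (initial_segments_indexed W HW) as (f & Hf & Hfm).
  exists (fun sigma => Some (f (h (encode_list sigma)))). split.
  - exists (fun c => S (f (h c))). split; [|reflexivity].
    apply recursive_S, (recursive_comp1 1 f); [exact Hf | exact Hh].
  - intros L [n HL] T HT. split.
    + destruct (text_exhausts_below T L (a n) HT) as [N HN].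
      { intros x Hx. apply HL. now apply ascending_set_below. }
      exists (f (a n)), N. split.
      * intros k Hk. do 2 f_equal.
        destruct (Hmex (initial_segment T k)) as [Hout Hin].
        (* The least missing number is not below [a n], as all those numbers have appeared by stage
           [N], and not above it, as [a n] would then occur in a text for [A_n]. *)
        destruct (Nat.lt_trichotomy (h (encode_list (initial_segment T k))) (a n))
          as [H | [H | H]]; [|exact H|].
        -- destruct Hout. now apply HN.
        -- apply Hin, cnt_initial_segment in H. destruct H as (i & _ & Hi).
           destruct (not_ascending_set_least eta Heq a Ha n).
           apply HL, HT. now exists i.
      * intros x. rewrite HL, <- (closure_below_least eta Heq a Ha).
        split; intros (y & Hy & Hxy); exists y; split; auto; now apply Hfm.
    (* If the old conjecture contains all the data seen later, the least missing number is shown to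
       be unchanged, so the output is too. *)
    + intros n' k e _ E Hne Hsub. injection E as <-. apply Hne. do 2 f_equal.
      destruct (Hmex (initial_segment T n')) as [Hout Hin].
      destruct (Hmex (initial_segment T (n' + k))) as [Hout' Hin'].
      apply Nat.le_antisymm; apply Nat.nlt_ge; intros H.
      (* It cannot decrease, since data are never lost. *)
      * apply Hout', cnt_initial_segment. apply Hin, cnt_initial_segment in H.
        destruct H as (i & Hi & E). exists i. split; [lia | exact E].
      (* If it increased, its old value would have occurred and so be in the old conjecture, hence
         less than itself. *)
      * apply Hin', Hsub, Hfm in H. lia.
Qed.
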